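(* Let $G=(V,E)$ be a locally finite, connected graph with graph metric $d$ and let $k\colon V\times V\to[0,\infty)$ be a measure definite kernel or an $L^1$-kernel. Then for every $t>0$ there exists a general bond percolation $\mathbf{P}_t$ on $G$, with configuration denoted $\omega$, which satisfies the FKG-inequality and the following: (i) for every edge $e=[u,v]\in E$, $$\mathbf{P}_t[e\in\omega]=\exp\big(-t\,k(u,v)\big);$$ (ii) for every $u,v\in V$, $$\exp\big(-t\,\delta\, d(u,v)\big)\ \le\ \mathbf{P}_t[u\leftrightarrow v]\ \le\ \exp\big(-t\,k(u,v)\big),$$ where $\delta:=\sup_{u\sim v}k(u,v)$. Moreover, there exists a monotonically decreasing coupling of the family $(\mathbf{P}_t)_{t>0}$.
   Context: Graphs have a vertex set $V$ and a set $E$ of undirected edges $[u,v]$; $u\sim v$ means that $u,v$ are adjacent. A graph is locally finite if every vertex has finite degree. For a connected graph, $d(u,v)$ is the length of a shortest path joining $u$ and $v$. A map $k\colon X\times X\to[0,\infty)$ is a measure definite kernel if there exist a measure space $(\Omega,\mathcal{B},\mu)$ and a map $X\to\mathcal{B}$, $x\mapsto S_x$, such that $k(x,y)=\mu(S_x\Delta S_y)$ for all $x,y\in X$. It is an $L^1$-kernel if there exist a measure space $(Y,\nu)$ and a map $f\colon X\to L^1(Y,\nu)$ such that $k(x,y)=\|f(x)-f(y)\|$ for all $x,y\in X$. A general bond percolation on $G$ is a probability measure $\mathbf{P}$ on subsets of $E$, i.e. on $\{0,1\}^E$ with its Borel $\sigma$-algebra. The configuration $\omega\subset E$ is identified with the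 induced subgraph with vertex set $V$ and edge set $\omega$; its connected components are called clusters, and $\{u\leftrightarrow v\}$ is the event that $u$ and $v$ lie in the same cluster of $\omega$. A Borel event $A\subset\{0,1\}^E$ is increasing if $\omega\in A$ and $\omega\le\omega'$ (coordinatewise) imply $\omega'\in A$. $\mathbf{P}$ satisfies the FKG-inequality if $\mathbf{P}(A\cap B)\ge\mathbf{P}(A)\mathbf{P}(B)$ for any two increasing events $A,B$. A monotonically decreasing coupling of $(\mathbf{P}_t)_{t>0}$ is a family of random subsets $(\omega_t)_{t>0}$ of $E$ on a common probability space such that $\omega_t$ has law $\mathbf{P}_t$ for every $t>0$ and $\omega_t\subset\omega_s$ whenever $s<t$. The value $\delta=\infty$ is allowed, with conventions $\infty\cdot0=0$ and $e^{-\infty}=0$; if $E=\emptyset$, $\delta:=0$. *)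

(* Defs.v *)
From mathcomp Require Import all_boot all_order all_algebra.
From mathcomp Require Import all_classical all_reals all_analysis.
Set Implicit Arguments.
Unset Strict Implicit.
Unset Printing Implicit Defensive.
Import Order.TTheory GRing.Theory Num.Theory.

Local Open Scope classical_set_scope.
Local Open Scope ring_scope.

(* A graph on the vertex type [V] is given by its edge set [E : set (set V)];
   the undirected edge [u,v] is the set [[set u; v]].  There are no multiple
   edges; loops are not excluded. *)
Definition undirected_graph (V : Type) (E : set (set V)) : Prop :=
  forall e, E e -> exists u v, e = [set u; v].

Definition adj (V : Type) (E : set (set V)) : rel V :=
  fun u v => `[< E [set u; v] >].

Definition locally_finite_graph (V : Type) (E : set (set V)) : Prop :=
  forall v, finite_set [set e | E e /\ e v].

Definition walk (V : Type) (E : set (set V)) (n : nat) (u v : V) : Prop :=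
  exists p : seq V, [/\ path (adj E) u p, last u p = v & size p = n].

Definition joined (V : Type) (E : set (set V)) (u v : V) : Prop :=
  exists n, walk E n u v.

Definition connected_graph (V : Type) (E : set (set V)) : Prop :=
  forall u v, joined E u v.

(* [get] returns the unique element of this set when [u] and [v] are joined. *)
Definition gdist (V : Type) (E : set (set V)) (u v : V) : nat :=
  get [set n | walk E n u v /\ forall m, walk E m u v -> (n <= m)%N].

(* A [measurableType] is nonempty; the empty measure space would only give
   [k = 0], which a one-point space gives as well. *)
Definition measure_definite_kernel (R : realType) (X : Type) (k : X -> X -> R)
    : Prop :=
  exists (d : measure_display) (Omega : measurableType d)
         (mu : {measure set Omega -> \bar R}) (S : X -> set Omega),
    (forall x, measurable (S x)) /\
    (forall x y, (k x y)%:E = mu (S x `+` S y)).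

(* [LspaceType1 nu] is the space of a.e.-classes of integrable functions; the
   library has no subtraction on classes, so the norm of the difference is
   computed on representatives. *)
Definition L1_kernel (R : realType) (X : Type) (k : X -> X -> R) : Prop :=
  exists (d : measure_display) (Y : measurableType d)
         (nu : {measure set Y -> \bar R}) (f : X -> LspaceType1 nu),
    forall x y, (k x y)%:E = ('N[nu]_1 [(fun z => (f x z - f y z)%:E)])%E.

(* {0,1}^E with the sigma-algebra generated by the open sets of the product
   topology; [E] is used as the type of its elements. *)
Definition config (V : Type) (E : set (set V)) : Type :=
  g_sigma_algebraType (@open {ptws E -> bool}).

Definition config_le (V : Type) (E : set (set V)) (w w' : config E) : Prop :=
  forall e : E, w e ==> w' e.

Definition open_edges (V : Type) (E : set (set V)) (w : config E)
    : set (set V) :=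
  val @` [set e : E | w e].

Definition same_cluster (V : Type) (E : set (set V)) (u v : V)
    : set (config E) :=
  [set w | joined (open_edges w) u v].
Arguments same_cluster {V} E u v.

Definition increasing_event (V : Type) (E : set (set V)) (A : set (config E))
    : Prop :=
  measurable A /\ forall w w', A w -> config_le w w' -> A w'.

Definition FKG (R : realType) (V : Type) (E : set (set V))
    (P : probability (config E) R) : Prop :=
  forall A B, increasing_event A -> increasing_event B ->
    (P A * P B <= P (A `&` B))%E.

(* Only the values at [t > 0] of the [R]-indexed families matter. *)
Definition decreasing_coupling (R : realType) (V : Type) (E : set (set V))
    (P : R -> probability (config E) R) : Prop :=
  exists (d : measure_display) (W : measurableType d) (Pr : probability W R)
         (omega : R -> {RV Pr >-> config E}),
    (forall t : R, 0 < t -> forall A, measurable A ->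
       distribution Pr (omega t) A = P t A) /\
    (forall s t : R, 0 < s -> s < t ->
       forall x, config_le (omega t x) (omega s x)).

(* The empty supremum of [\bar R] is [-oo], hence the separate case. *)
Definition edge_sup (R : realType) (V : Type) (E : set (set V))
    (k : V -> V -> R) : \bar R :=
  if `[< E = set0 >] then 0%E
  else ereal_sup [set x | exists u v, adj E u v /\ x = (k u v)%:E].

(* Main.v *)
Require Import Defs.
From HB Require Import structures.
From mathcomp Require Import all_boot all_order all_algebra.
From mathcomp Require Import all_classical all_reals all_analysis.
From mathcomp Require Import measurable_realfun.
From mathcomp Require Import ring lra zify.
Set Implicit Arguments.
Unset Strict Implicit.
Unset Printing Implicit Defensive.
Import Order.TTheory GRing.Theory Num.Theory.
Import numFieldNormedType.Exports.

Local Open Scope classical_set_scope.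
Local Open Scope ring_scope.

(** Why the theorem holds. An L^1-kernel is measure definite: with [S x] the set
of the points below the graph of [f x], the measure of [S x `+` S y] is the
L^1-distance. So let [k x y = mu (S x `+` S y)], drop the points of a Poisson
process of intensity [mu] times Lebesgue measure on [Omega * [0, +oo[], read the
last coordinate as time, and keep the edge [u,v] until the first point falls
into [S u `+` S v]. The probability that no point falls into a set before time
[t] is [exp (- t mu)], which is (i), and edges only disappear with time, which
is the coupling. For (ii): the sets of the edges along a path from [u] to [v]
cover [S u `+` S v], so [u] and [v] can be joined at time [t] only if no point
has fallen into [S u `+` S v]; and along a geodesic the union of these sets has
measure at most [delta * d(u,v)]. FKG holds because the configuration is a
decreasing function of a Poisson process.

This argument sees the Poisson process only through the joint law of the events
that no point lies in [B i], for countably many sets [B i] of finite measure: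
the probability that all the [B i] with [i] in [F] are void is the exponential
of minus the measure of their union. [exists_void_field] produces events with
these probabilities on the unit interval. The inclusion-exclusion principle
turns the void probabilities into the probabilities of the finite 0/1 words
(Section BitSequence); these are the lengths of nested intervals, and the word
of a uniform point of [0, 1[ is the word of the intervals that contain it. The
lengths are nonnegative because finitely many [B i] generate finitely many
atoms, and making each atom void independently of the others realises the
finite-dimensional law ([void_probability_thinning]).

This independent realisation also proves FKG for events that depend on finitely
many edges: Harris' inequality, by induction on the atoms ([thin_associated]).
For a general increasing event [A], take a closed [K] inside [A] of almost full
measure (the probability is regular, Section Regularity), and replace it by the
events that see only the first [n] edges of a configuration above a point of
[K]. These are increasing and, by compactness of the configuration space, they
decrease to a subset of [A] ([FKG_of_void]).

The coupling uses the sets [B] indexed by pairs of vertices and rational times;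
an edge survives until [t] if it is void at all the rational times up to [t],
which makes the configuration decrease in [t] surely, not just almost surely. *)

(** * Independent thinning of a finite set *)

Section Thinning.
Variables (R : realType) (I : finType).
Local Open Scope ring_scope.
Implicit Types (s : seq ({set I} * R)) (g h : {set I} -> R) (S X Y : {set I}).

(** The expectation of [g] after the sets [a] have been removed from [X],
independently of each other and each with probability [1 - c]. *)
Fixpoint thin s g X : R :=
  if s is (a, c) :: s' then
    c * thin s' g X + (1 - c) * thin s' g (X :\: a) else g X.

Definition is_prob (x : R) : bool := (0 <= x) && (x <= 1).

Lemma eq_thin s g h X : g =1 h -> thin s g X = thin s h X.
Proof.
by move=> gh; elim: s X => [|[a c] s IH] X /=; rewrite ?gh// !IH.
Qed.

Lemma thin_sum (J : Type) (r : seq J) (k : J -> R) (G : J -> {set I} -> R) s X :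
  thin s (fun Y => \sum_(j <- r) k j * G j Y) X
  = \sum_(j <- r) k j * thin s (G j) X.
Proof.
elim: s X => [//|[a c] s IH] X /=; rewrite !IH !big_distrr/= -big_split/=.
by apply: eq_bigr => j _; ring.
Qed.

Lemma thinB s g h X :
  thin s (fun Y => g Y - h Y) X = thin s g X - thin s h X.
Proof. by elim: s X => [//|[a c] s IH] X /=; rewrite !IH; ring. Qed.

Lemma thin_ge0 s g X : all is_prob (unzip2 s) ->
  (forall Y, 0 <= g Y) -> 0 <= thin s g X.
Proof.
elim: s X => [//|[a c] s IH] X /= /andP[/andP[c0 c1] /IH{}IH] g0.
by rewrite addr_ge0// mulr_ge0 ?subr_ge0// IH.
Qed.

Lemma thin_homo s g : all is_prob (unzip2 s) ->
  {homo g : X Y / X \subset Y >-> X <= Y} ->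
  {homo thin s g : X Y / X \subset Y >-> X <= Y}.
Proof.
elim: s => [//|[a c] s IH] /= /andP[/andP[c0 c1] /IH{}IH] gm X Y XY.
apply: lerD; apply: ler_wpM2l; rewrite ?subr_ge0//; first exact: IH.
by apply: IH => //; exact: finset.setSD.
Qed.

(** Harris' inequality. Conditioning on whether [a] is removed, the two
conditional expectations of [g] are ordered as those of [h] are: this makes the
covariance over that choice, [c (1 - c) (G - G') (H - H')], nonnegative. *)
Lemma thin_associated s g h X : all is_prob (unzip2 s) ->
  {homo g : X Y / X \subset Y >-> X <= Y} ->
  {homo h : X Y / X \subset Y >-> X <= Y} ->
  thin s g X * thin s h X <= thin s (fun Y => g Y * h Y) X.
Proof.
elim: s X => [//|[a c] s IH] X /= /andP[/andP[c0 c1] ps] gm hm.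
have gD := thin_homo ps gm (finset.subsetDl X a).
have hD := thin_homo ps hm (finset.subsetDl X a).
have := IH X ps gm hm; have := IH (X :\: a) ps gm hm.
set G := thin s g X in gD *; set H := thin s h X in hD *.
set G' := thin s g _ in gD *; set H' := thin s h _ in hD *.
move=> IH1 IH0.
apply: (@le_trans _ _ (c * (G * H) + (1 - c) * (G' * H'))); last first.
  by apply: lerD; apply: ler_wpM2l; rewrite ?subr_ge0.
have : 0 <= c * (1 - c) * ((G - G') * (H - H')).
  by rewrite !mulr_ge0 ?subr_ge0.
rewrite -subr_ge0 => D0; rewrite -subr_ge0; apply: le_trans D0 _.
rewrite le_eqVlt; apply/orP; left.
by apply/eqP; ring.
Qed.

Lemma thin_up s S X :
  thin s (fun Y => (S \subset Y)%:R) X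
  = (S \subset X)%:R * \prod_(p <- s | ~~ [disjoint p.1 & S]) p.2.
Proof.
elim: s X => [|[a c] s IH] X; first by rewrite big_nil mulr1.
rewrite /= !IH big_cons /= finset.subsetD disjoint_sym.
by case: (S \subset X); case: (fintype.disjoint _ _) => /=; ring.
Qed.

(** Moebius inversion, by induction on the size of the complement: the sums over
the supersets of [S] determine the weights. *)
Lemma moebius_eq (p q : {set I} -> R) :
  (forall S, \sum_(X : {set I} | S \subset X) p X = \sum_(X : {set I} | S \subset X) q X) ->
  p =1 q.
Proof.
move=> pq S; have [n] := ubnP #|~: S|; elim: n S => // n IH S /ltnSE Sn.
have := pq S; rewrite (bigD1 S)//= [RHS](bigD1 S)//=.
rewrite (eq_bigr q) => [/addIr//|X /andP[SX XS]]; apply: IH.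
apply: leq_trans Sn; apply: proper_card.
by rewrite finset.properEneq finset.setCS SX andbT; apply: contra XS => /eqP/finset.setC_inj->.
Qed.

(** A law on the subsets of [I] is known once the probabilities of containing [S]
are, so that any law with the void probabilities of a thinning has also its
expectations. *)
Lemma thin_expectation s (p g : {set I} -> R) :
  (forall S, \sum_(X : {set I} | S \subset X) p X
     = thin s (fun Y => (S \subset Y)%:R) [set: I]) ->
  \sum_X g X * p X = thin s g [set: I].
Proof.
move=> ps.
(* Expand [g] and [p] along the indicators of single subsets. *)
have dE h : h =1 fun Y => \sum_X h X * (Y == X)%:R.
  move=> Y; rewrite (bigD1 Y)//= eqxx mulr1 big1 ?addr0// => X XY.
  by rewrite eq_sym (negbTE XY) mulr0.
have pE : p =1 fun X => thin s (fun Y => (Y == X)%:R) [set: I].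
  apply: moebius_eq => S; rewrite ps.
  rewrite (eq_thin _ _ (dE _)) thin_sum [RHS]big_mkcond/=.
  by apply: eq_bigr => X _; case: (S \subset X); rewrite ?mul1r ?mul0r.
under eq_bigr do rewrite pE.
by rewrite -thin_sum; apply: eq_thin => Y; rewrite -dE.
Qed.

End Thinning.

(** * Void probabilities of finitely many sets *)

Lemma measure_finite_fibers d (M : measurableType d) (R : realType)
    (mu : {measure set M -> \bar R}) (J : finType) (X : M -> J) (P : pred J) :
  (forall j, measurable (X @^-1` [set j])) ->
  mu [set x | P (X x)] = (\sum_(j | P j) mu (X @^-1` [set j]))%E.
Proof.
move=> mX; have -> : [set x | P (X x)] = \bigcup_(j in [set` P]) X @^-1` [set j].
  by apply/seteqP; split=> [x Px|x [j Pj xj]]; [exists (X x)|by move: Pj; rewrite -xj].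
rewrite measure_fin_bigcup//=.
  rewrite [RHS]bigfs//= ?index_enum_uniq// => j _.
  by rewrite mem_index_enum.
by move=> a b _ _ [x [<- <-]].
Qed.

Lemma measurable_finite_fibers d (M : measurableType d) (J : finType)
    (X : M -> J) (P : set J) :
  (forall j, measurable (X @^-1` [set j])) -> measurable (X @^-1` P).
Proof.
move=> mX; have -> : X @^-1` P = \bigcup_(j in P) X @^-1` [set j].
  by apply/seteqP; split=> [x Px|x [j Pj xj]]; [exists (X x)|by move: Pj; rewrite -xj].
by apply: fin_bigcup_measurable => //; exact: finite_finset.
Qed.

Lemma measurable_pattern d (M : measurableType d) (I : finType) (B : I -> set M)
    (a : {set I}) : (forall i, measurable (B i)) ->
  measurable ((fun x => [set i | `[< B i x >]]%SET) @^-1` [set a]).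
Proof.
move=> mB; rewrite (_ : _ @^-1` _ =
    \bigcap_(i in [set: I]) (if i \in a then B i else ~` B i)).
  apply: fin_bigcap_measurable; first exact: finite_finset.
  by move=> i _; case: ifP => // _; exact: measurableC.
apply/seteqP; split=> [x <- i _|x xa].
  by rewrite inE; case: asboolP.
apply/setP => i; rewrite inE; have := xa i Logic.I.
by case: ifPn => _ /asboolP; [|rewrite asbool_neg => /negbTE].
Qed.

Section MarshallOlkin.
Context d (M : measurableType d) (R : realType).
Variables (nu : {measure set M -> \bar R}) (I : finType) (B : I -> set M).
Hypotheses (mB : forall i, measurable (B i)) (Bfin : forall i, (nu (B i) < +oo)%E).

Let pattern (x : M) : {set I} := [set i | `[< B i x >]]%SET.

Let nu_atoms (S : {set I}) : nu (\bigcup_(i in [set` S]) B i) =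
  (\sum_(a : {set I} | ~~ [disjoint a & S]) nu (pattern @^-1` [set a]))%E.
Proof.
rewrite -measure_finite_fibers; last by move=> a; exact: measurable_pattern.
congr (nu _); apply/seteqP; split=> [x [i /= iS Bix]|x /=].
  by apply/pred0Pn; exists i => /=; rewrite iS andbT inE; apply/asboolP.
by move/pred0Pn=> [i /= /andP[+ iS]]; rewrite inE => /asboolP; exists i.
Qed.

(** A point of [M] matters only through its pattern, the set [a] of the indices of
the [B i] that contain it; removing [a] means that some Poisson point has this pattern, and the
sets [B i] with [i] in [S] are all void if no pattern meeting [S] is removed. *)
Lemma void_probability_thinning : exists s : seq ({set I} * R),
  all (@is_prob R) (unzip2 s) /\
  forall S : {set I}, thin s (fun Y : {set I} => (S \subset Y)%:R) [set: I]%SET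
    = expR (- fine (nu (\bigcup_(i in [set` S]) B i))).
Proof.
pose c a := expR (- fine (nu (pattern @^-1` [set a]))).
exists [seq (a, c a) | a <- enum {: {set I}}]; split.
  rewrite /unzip2 -map_comp all_map; apply/allP => a _ /=.
  rewrite /is_prob expR_ge0 -expR0 ler_expR oppr_le0 fine_ge0//.
move=> S; rewrite thin_up finset.subsetT mul1r big_map -big_filter.
rewrite nu_atoms -sum_fine.
  by rewrite -sumrN expR_sum big_filter big_enum_cond.
move=> a /pred0Pn[i /= /andP[ia _]]; rewrite ge0_fin_numE//.
apply: le_lt_trans (Bfin i); apply: le_measure; rewrite ?inE//.
  exact: measurable_pattern.
by move=> x /= xa; move: ia; rewrite -xa inE => /asboolP.
Qed.
End MarshallOlkin.

(** * Random bits on the unit interval *)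

Definition lebesgue01 (R : realType) : set (measurableTypeR R) -> \bar R :=
  mrestr (@lebesgue_measure R) (measurable_itv `[0 : R, 1[).

HB.instance Definition _ (R : realType) := Measure.on (@lebesgue01 R).

Lemma lebesgue01_setT (R : realType) : @lebesgue01 R setT = 1%E.
Proof.
by rewrite /lebesgue01 /mrestr setTI lebesgue_measure_itv/= lte01 oppr0 adde0.
Qed.

HB.instance Definition _ (R : realType) :=
  Measure_isProbability.Build _ _ _ (@lebesgue01 R) (@lebesgue01_setT R).

Section BitSequence.
Variables (R : realType) (void : set nat -> R).

(** The probability that the bits at the positions below [size w] spell [w] and
that those in [S] are all [true], in terms of [void], the probability of the
latter. Words are written backwards, the last bit first, so that the head of
[b :: w] sits at the position [size w]. *)
Fixpoint cyl (S : set nat) (w : seq bool) : R :=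
  match w with
  | [::] => void S
  | true :: w' => cyl (size w' |` S) w'
  | false :: w' => cyl S w' - cyl (size w' |` S) w'
  end.

Hypothesis void_thinning : forall N, exists s : seq ({set 'I_N.+1} * R),
  all (@is_prob R) (unzip2 s) /\
  forall S : {set 'I_N.+1},
    thin s (fun Y : {set 'I_N.+1} => (S \subset Y)%:R) [set: 'I_N.+1]%SET
    = void (@nat_of_ord N.+1 @` [set` S]).
Hypothesis void0 : void set0 = 1.

Let agree N (w : seq bool) (Y : {set 'I_N.+1}) : bool :=
  [forall i : 'I_N.+1, (i < size w)%N ==> ((i \in Y) == nth true (rev w) i)].

Let agree_cons N b (w : seq bool) (Y : {set 'I_N.+1}) : (size w <= N)%N ->
  agree (b :: w) Y = ((inord (size w) \in Y) == b) && agree w Y.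
Proof.
move=> wN; apply/forallP/andP => [H|[/eqP Hb /forallP H] i].
  split.
    have := H (inord (size w)); rewrite (inordK (wN : (size w < N.+1)%N)) ltnSn /=.
    by rewrite rev_cons nth_rcons size_rev ltnn eqxx.
  apply/forallP => i; apply/implyP => iw; have := H i.
  by rewrite /= ltnS ltnW//= rev_cons nth_rcons size_rev iw.
apply/implyP; rewrite /= ltnS leq_eqVlt => /orP[/eqP iw|iw].
  by rewrite rev_cons nth_rcons size_rev iw ltnn eqxx -Hb -iw inord_val.
by have := H i; rewrite iw rev_cons nth_rcons size_rev iw.
Qed.

(** Inclusion-exclusion alone does not give the sign: [cyl] is seen to be the
expectation of an indicator under the thinning that realises [void]. *)
Lemma cyl_ge0 w : 0 <= cyl set0 w.
Proof.
have [s [ps sE]] := void_thinning (size w).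
(* The extra indicator of [S] makes the statement stable under the recursion. *)
suff H v (S : {set 'I_(size w).+1}) : (size v <= size w)%N ->
    cyl (@nat_of_ord (size w).+1 @` [set` S]) v =
    thin s (fun Y : {set 'I_(size w).+1} => (S \subset Y)%:R * (agree v Y)%:R) [set: _]%SET.
  have -> : set0 = @nat_of_ord (size w).+1 @` [set` (finset.set0 : {set 'I_(size w).+1})].
    by apply/seteqP; split=> [//|_ [i /= + _]]; rewrite inE.
  by rewrite H//; apply: thin_ge0 => // Y; rewrite mulr_ge0.
elim: v S => [|b v IH] S /= vw.
  rewrite -sE; apply: eq_thin => Y; rewrite (_ : agree _ _) ?mulr1//.
  by apply/forallP.
have -> : size v |` (@nat_of_ord (size w).+1 @` [set` S]) =
    @nat_of_ord (size w).+1 @` [set` (inord (size v) |: S)%SET].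
  apply/seteqP; split=> [_ [->|[i /= iS <-]]|_ [i /= + <-]].
  - by exists (inord (size v)); rewrite /= ?inE ?eqxx// inordK// ltnS ltnW.
  - by exists i; rewrite //= !inE iS orbT.
  - rewrite !inE => /orP[/eqP ->|iS]; [left|by right; exists i].
    by rewrite inordK// ltnS ltnW.
have vw' := ltnW vw.
case: b; rewrite !IH// -?thinB; apply: eq_thin => Y;
  rewrite agree_cons// finset.subUset finset.sub1set;
  by case: (inord _ \in _); case: (_ \subset _); case: (agree _ _);
    rewrite /= ?(mulr1, mulr0, mul0r, mul1r, subr0, subrr).
Qed.

Lemma cyl_split S w : cyl S (true :: w) + cyl S (false :: w) = cyl S w.
Proof. by rewrite /= addrC subrK. Qed.

(** The word [w] owns the interval of length [cyl set0 w] that starts at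
[left_end w]; it is cut into those of [true :: w] and [false :: w], in this
order. *)
Fixpoint left_end (w : seq bool) : R :=
  if w is b :: w' then
    if b then left_end w' else left_end w' + cyl set0 (true :: w')
  else 0.

Definition cut (w : seq bool) : R := left_end w + cyl set0 (true :: w).

Lemma left_end_cons b w : left_end (b :: w) = if b then left_end w else cut w.
Proof. by []. Qed.

Fixpoint word (x : R) (n : nat) : seq bool :=
  if n is m.+1 then (x < cut (word x m)) :: word x m else [::].

Definition bit (n : nat) (x : R) : bool := x < cut (word x n).

Lemma wordP x w : 0 <= x < 1 ->
  word x (size w) = w <-> left_end w <= x < left_end w + cyl set0 w.
Proof.
move=> x01; elim: w => [|b w IH]; first by rewrite /= void0 add0r x01.
have c1 := cyl_ge0 (true :: w); have c2 := cyl_ge0 (false :: w).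
have cs := cyl_split set0 w.
have -> : left_end (b :: w) <= x < left_end (b :: w) + cyl set0 (b :: w) <->
    (left_end w <= x < left_end w + cyl set0 w) /\ (x < cut w) = b.
  rewrite left_end_cons /cut -cs; case: b;
    move: c1 c2; move: (cyl _ (true :: w)) (cyl _ (false :: w)) => T F c1 c2.
    split=> [/andP[Lx xT]|[/andP[-> _] ->//]].
    by split=> //; apply/andP; split=> //; lra.
  split=> [/andP[xT xF]|[/andP[xT xF] /negbT]].
    by split; [apply/andP; split; lra|apply/negbTE; rewrite -leNgt; lra].
  by rewrite -leNgt => xT'; apply/andP; split; lra.
rewrite -IH /=; split=> [[]|].
  by move=> wb ww; rewrite ww in wb *.
by case=> -> ->.
Qed.

Lemma measurable_word n w : measurable [set x : measurableTypeR R | word x n = w].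
Proof.
elim: n w => [|n IH] [|b w].
- rewrite (_ : [set _ | _] = setT); first exact: measurableT.
  by apply/seteqP; split.
- rewrite (_ : [set _ | _] = set0); first exact: measurable0.
  by apply/seteqP; split.
- rewrite (_ : [set _ | _] = set0); first exact: measurable0.
  by apply/seteqP; split.
rewrite (_ : [set _ | _] = [set x | word x n = w] `&` [set x | (x < cut w) = b]).
  apply: measurableI => //; case: b.
    by rewrite (_ : [set _ | _] = `]-oo, cut w[%classic).
  rewrite (_ : [set _ | _] = `[cut w, +oo[%classic)//.
  apply/seteqP; split=> x; rewrite /= in_itv/= andbT leNgt; first by move=> ->.
  by move=> /negbTE.
by apply/seteqP; split=> x /= [] => [<- <-//|<- <-].
Qed.

Lemma measurable_bit n : measurable [set x : measurableTypeR R | bit n x].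
Proof.
rewrite (_ : [set _ | _] = \bigcup_w [set x | word x n.+1 = true :: w]).
  apply: countable_bigcupT_measurable => [|w]; first exact: countableP.
  exact: measurable_word.
apply/seteqP; split=> [x /= bx|x [w _ /= []]]; last by rewrite /bit => ->.
by exists (word x n); rewrite //= /bit in bx *; rewrite bx.
Qed.

Lemma lebesgue01_word w : lebesgue01 [set x : R | word x (size w) = w] = (cyl set0 w)%:E.
Proof.
have lr : 0 <= left_end w /\ left_end w + cyl set0 w <= 1.
  elim: w => [|b w [IH1 IH2]]; first by rewrite /= add0r void0.
  have := cyl_ge0 (true :: w); have := cyl_ge0 (false :: w).
  have := cyl_split set0 w; rewrite left_end_cons /cut.
  by case: b; move: (cyl _ (true :: w)) (cyl _ (false :: w)) => T F; lra.
rewrite /lebesgue01 /mrestr.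
rewrite (_ : _ `&` _ = `[left_end w, left_end w + cyl set0 w[%classic).
  rewrite lebesgue_measure_itv/= lte_fin ltrDl lt_neqAle cyl_ge0 andbT eq_sym.
  case: eqP => [->//|_] /=; by rewrite -EFinB addrAC subrr add0r.
apply/seteqP; split=> x /=; rewrite !in_itv/=.
  by case=> xw x01; apply/wordP.
move=> xw; have x01 : 0 <= x < 1 by lra.
by split=> //; apply/wordP.
Qed.

End BitSequence.

(** * Void probabilities of countably many sets *)

Section VoidProbability.
Variables (R : realType) (void : set nat -> R).
Hypothesis void_thinning : forall N, exists s : seq ({set 'I_N.+1} * R),
  all (@is_prob R) (unzip2 s) /\
  forall S : {set 'I_N.+1},
    thin s (fun Y : {set 'I_N.+1} => (S \subset Y)%:R) [set: 'I_N.+1]%SET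
    = void (@nat_of_ord N.+1 @` [set` S]).
Hypothesis void0 : void set0 = 1.

Lemma measurable_bits (F : set nat) :
  measurable [set x : measurableTypeR R | forall i, F i -> bit void i x].
Proof.
rewrite (_ : [set _ | _] = \bigcap_(i in F) [set x | bit void i x])//.
by apply: bigcap_measurableType => i _; exact: measurable_bit.
Qed.

(** Downward induction on the number of bits already read: a position in [F] must
continue with [true], which is the recursion for [cyl], and over any other
position the two continuations add up. *)
Lemma lebesgue01_bits_fin (F : set nat) (N : nat) :
  lebesgue01 [set x : R | forall i, (F `&` `I_N) i -> bit void i x]
  = (void (F `&` `I_N))%:E.
Proof.
suff H m w : (m + size w = N)%N ->
    lebesgue01 ([set x : R | word void x (size w) = w] `&`
       [set x | forall i, (F `&` `[size w, N[%classic) i -> bit void i x])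
    = (cyl void (F `&` `[size w, N[%classic) w)%:E.
  have -> : `I_N = `[0%N, N[%classic by apply/seteqP; split=> i; rewrite /= in_itv.
  have := H N [::]; rewrite addn0 => /(_ erefl) /= <-; congr (lebesgue01 _).
  by apply/seteqP; split=> [x ? //|x []].
elim: m w => [|m IH] w mw.
  have -> : F `&` `[size w, N[%classic = set0.
    by apply/seteqP; split=> // i [_] /=; rewrite in_itv/= -mw leEnat ltEnat/=; lia.
  rewrite -(lebesgue01_word void_thinning void0); congr (lebesgue01 _).
  by apply/seteqP; split=> x; [case|split].
have mE b : (m + size (b :: w) = N)%N by rewrite /= addnS.
have itvE : `[size w, N[%classic = size w |` `[(size w).+1, N[%classic.
  apply/seteqP; split=> i /=; rewrite !in_itv/= ?leEnat ?ltEnat/= -?mw.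
    case: (ltngtP i (size w)) => //= [wi|->]; [right|by left]; lia.
  by case=> [->|]; lia.
pose T b := [set x : R | word void x (size (b :: w)) = b :: w] `&`
  [set x | forall i, (F `&` `[size (b :: w), N[%classic) i -> bit void i x].
have mT b : measurable (T b : set (measurableTypeR R)).
  by apply: measurableI; [exact: measurable_word|exact: measurable_bits].
have [Fw|Fw] := pselect (F (size w)).
  have -> : F `&` `[size w, N[%classic = size w |` (F `&` `[(size w).+1, N[%classic).
    by rewrite itvE setIUr; congr (_ `|` _); apply/seteqP; split=> [i []|i ->].
  rewrite -[RHS](IH (true :: w))//; congr (lebesgue01 _).
  apply/seteqP; split=> x /= [xw xb].
    split; last by move=> i Fi; apply: xb; right.
    rewrite xw; congr (_ :: _).
    by have := xb _ (or_introl erefl); rewrite /bit xw.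
  case: xw => xw1 xw; split=> // i [->|]; last exact: xb.
  by rewrite /bit.
have -> : F `&` `[size w, N[%classic = F `&` `[(size w).+1, N[%classic.
  rewrite itvE setIUr (_ : F `&` [set size w] = set0) ?set0U//.
  by apply/seteqP; split=> // i [/[swap] ->].
rewrite -cyl_split EFinD -(IH (true :: w))// -(IH (false :: w))//.
rewrite -[RHS]/(lebesgue01 (T true) + lebesgue01 (T false))%E -measureU//.
  congr (lebesgue01 _); apply/seteqP; split=> x.
    move=> /= [xw xb]; case E: (x < cut void w); [left|right];
      by split=> //=; rewrite xw E.
  by case=> -[/= [_ xw]] xb; split.
by apply/seteqP; split=> // x [[/= [+ _] _] [[+ _] _]] => -> .
Qed.

End VoidProbability.

Section PoissonBits.
Context d (M : measurableType d) (R : realType).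
Variables (nu : {measure set M -> \bar R}) (B : nat -> set M).
Hypotheses (mB : forall i, measurable (B i)) (Bfin : forall i, (nu (B i) < +oo)%E).

Definition void_prob (S : set nat) : R :=
  expR (- fine (nu (\bigcup_(i in S) B i))).

Lemma void_prob_thinning N : exists s : seq ({set 'I_N.+1} * R),
  all (@is_prob R) (unzip2 s) /\
  forall S : {set 'I_N.+1},
    thin s (fun Y : {set 'I_N.+1} => (S \subset Y)%:R) [set: 'I_N.+1]%SET
    = void_prob (@nat_of_ord N.+1 @` [set` S]).
Proof.
have [s [ps sE]] := void_probability_thinning
  (fun i : 'I_N.+1 => mB i) (fun i : 'I_N.+1 => Bfin i).
by exists s; split=> // S; rewrite sE /void_prob bigcup_image.
Qed.

Lemma void_prob0 : void_prob set0 = 1.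
Proof. by rewrite /void_prob bigcup_set0 measure0 oppr0 expR0. Qed.

(** Infinitely many conditions: both sides are continuous along the initial
segments of [F]. *)
Lemma lebesgue01_bits (F : set nat) :
  (nu (\bigcup_(i in F) B i) < +oo)%E ->
  lebesgue01 [set x : R | forall i, F i -> bit void_prob i x] = (void_prob F)%:E.
Proof.
move=> Ffin.
have mU (G : set nat) : measurable (\bigcup_(i in G) B i).
  exact: bigcup_measurable.
have Gfin G : G `<=` F -> nu (\bigcup_(i in G) B i) \is a fin_num.
  move=> GF; rewrite ge0_fin_numE//; apply: le_lt_trans Ffin.
  by apply: le_measure; rewrite ?inE//; exact: bigcup_subset.
pose A n := [set x : measurableTypeR R | forall i, (F `&` `I_n) i -> bit void_prob i x].
have AE : [set x : measurableTypeR R | forall i, F i -> bit void_prob i x] = \bigcap_n A n.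
  apply/seteqP; split=> [x xF n _ i [Fi _]|x xA i Fi]; first exact: xF.
  by apply: (xA i.+1) => //; split=> //=.
have cA : lebesgue01 (A n) @[n --> \oo] --> lebesgue01 (\bigcap_n A n).
  apply: nonincreasing_cvg_mu.
  - by rewrite (le_lt_trans (probability_le1 _ _)) ?ltry//; exact: measurable_bits.
  - by move=> n; exact: measurable_bits.
  - by apply: bigcapT_measurable => n; exact: measurable_bits.
  - move=> m n mn; apply/subsetPset => x xA i [Fi /= im]; apply: xA; split=> //=.
    exact: leq_trans mn.
have cU : (void_prob (F `&` `I_n))%:E @[n --> \oo] --> (void_prob F)%:E.
  apply/fine_cvgP; split; first by apply: nearW.
  rewrite (_ : _ \o _ = expR \o (fun n => - fine (nu (\bigcup_(i in F `&` `I_n) B i))))//.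
  rewrite [void_prob F]/void_prob.
  apply: continuous_cvg; first exact: continuous_expR.
  apply: cvgN; apply: fine_cvg; rewrite fineK ?Gfin//.
  have -> : \bigcup_(i in F) B i = \bigcup_n \bigcup_(i in F `&` `I_n) B i.
    apply/seteqP; split=> [x [i Fi Bx]|x [n _ [i [Fi _] Bx]]]; last by exists i.
    by exists i.+1 => //; exists i => //; split=> //=.
  apply: nondecreasing_cvg_mu => //; first exact: bigcupT_measurable.
  move=> m n mn; apply/subsetPset; apply: bigcup_subset => i [Fi /= im].
  by split=> //=; exact: leq_trans mn.
rewrite AE; apply: cvg_unique cA _ => //.
rewrite (_ : (fun n => _) = fun n => (void_prob (F `&` `I_n))%:E)//.
apply/funext => n; rewrite -(lebesgue01_bits_fin void_prob_thinning void_prob0)//.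
Qed.

End PoissonBits.

(** * The space of configurations *)

Section PointwiseTopology.
Variables (T : eqType) (c : T -> nat).
Hypothesis c_inj : injective c.
Local Notation cfg := {ptws T -> bool}.
Implicit Types (w : cfg) (A O K : set cfg).

Definition agree_below n w w' : Prop := forall e, (c e < n)%N -> w' e = w e.

(** The filter of the cylinders around [w] converges to [w] coordinatewise, which
identifies it with the neighborhood filter of the product topology. *)
Let cyl_filter w : set_system cfg := [set A | exists n, agree_below n w `<=` A].

Let cyl_filterP w : ProperFilter (cyl_filter w).
Proof.
split; first by move=> [n /(_ w)]; apply.
split; first by exists 0%N.
- move=> A B [n nA] [m mB]; exists (maxn n m) => w' ww'; split.
    by apply: nA => e en; apply: ww'; rewrite leq_max en.
  by apply: mB => e em; apply: ww'; rewrite leq_max em orbT.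
- by move=> A B AB [n nA]; exists n; exact: subset_trans AB.
Qed.

Let nbhs_agree_below w n : nbhs w (agree_below n w).
Proof.
elim: n => [|n IH]; first by apply: filterS filterT => w' _ e.
have nE : nbhs w [set w' : cfg | forall e, c e = n -> w' e = w e].
  have [[e en]|ne] := pselect (exists e, c e = n); last first.
    by apply: filterS filterT => w' _ e en; case: ne; exists e.
  have := @proj_continuous T (fun=> bool) e w.
  move=> /(_ [set w e]) /= h; have : nbhs w (proj e @^-1` [set w e]).
    by apply: h; apply: discrete_set1.
  apply: filterS => w' /= we e'; rewrite -en => /c_inj ->; exact: we.
apply: filterS (filterI IH nE) => w' [h1 h2] e; rewrite ltnS leq_eqVlt.
by case/orP => [/eqP/h2|/h1].
Qed.

Lemma nbhs_ptwsP w A : nbhs w A <-> exists n, agree_below n w `<=` A.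
Proof.
split=> [wA|[n nA]]; last exact: filterS nA (nbhs_agree_below w n).
suff : cyl_filter w --> w by apply.
have FF := cyl_filterP w.
apply/cvg_sup => e; apply/cvg_image.
  by apply/seteqP; split=> // b _; exists (fun=> b).
move=> B /= wB; exists [set w' : cfg | B (w' e)].
  exists (c e).+1 => w' ww' /=; rewrite ww'//.
  by apply: nbhs_singleton.
by apply/seteqP; split=> [_ [w' /= + <-] //|b Bb]; exists (fun=> b).
Qed.

Lemma open_ptwsP O :
  open O <-> forall w, O w -> exists n, agree_below n w `<=` O.
Proof.
rewrite openE; split=> H w Ow; first by apply/nbhs_ptwsP; exact: H.
by apply/nbhs_ptwsP; exact: H.
Qed.

Lemma open_determined O n :
  (forall w w', agree_below n w w' -> O w -> O w') -> open O.
Proof. by move=> H; apply/open_ptwsP => w Ow; exists n => w' /H; apply. Qed.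

Lemma closed_determined O n :
  (forall w w', agree_below n w w' -> O w -> O w') -> closed O.
Proof.
move=> H; rewrite -openC; apply: (@open_determined _ n) => w w' ww' nOw /H.
by move=> /(_ w) h; apply: nOw; apply: h => e en; rewrite ww'.
Qed.

(** Compactness: a cluster point of the points of [K] that lie below [w] on longer
and longer initial segments lies in [K] and below [w]. *)
Lemma closed_increasing_approx K w : closed K ->
  (forall n, exists2 k : cfg, K k & forall e, (c e < n)%N -> k e ==> w e) ->
  exists2 k : cfg, K k & forall e, k e ==> w e.
Proof.
move=> cK Kn.
pose D n : set cfg := [set k | K k /\ forall e, (c e < n)%N -> k e ==> w e].
pose G : set_system cfg := [set A | exists n, D n `<=` A].
have GF : ProperFilter G.
  split; first by move=> [n nA]; have [k Kk kw] := Kn n; apply: (nA k).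
  split; first by exists 0%N.
  - move=> A B [n nA] [m mB]; exists (maxn n m) => k [Kk kw]; split.
      by apply: nA; split=> // e en; apply: kw; rewrite leq_max en.
    by apply: mB; split=> // e em; apply: kw; rewrite leq_max em orbT.
  - by move=> A B AB [n nA]; exists n; exact: subset_trans AB.
have := @tychonoff T (fun=> bool) (fun=> setT) (fun=> bool_compact) G GF.
have GT : G [set f : cfg | forall i, [set: bool] (f i)] by exists 0%N.
move=> /(_ GT) [k [_ Gk]].
have DG n : G (D n) by exists n.
exists k.
  move/closure_id : cK => ->; move=> N kN; have [k' [[Kk' _] Nk']] := Gk _ _ (DG 0%N) kN.
  by exists k'.
move=> e; have kN : nbhs k (agree_below (c e).+1 k) by apply/nbhs_ptwsP; exists (c e).+1.
have [k' [[_ /(_ e)]]] := Gk _ _ (DG (c e).+1) kN.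
by rewrite ltnSn => /(_ isT) + /(_ e); rewrite ltnSn => + /(_ isT) <-.
Qed.

End PointwiseTopology.

Section Regularity.
Variables (T : eqType) (c : T -> nat).
Hypothesis c_inj : injective c.
Local Notation cfg := {ptws T -> bool}.
Local Notation mcfg := (g_sigma_algebraType (@open cfg)).
Variables (R : realType) (P : probability mcfg R).
Implicit Types (A O K : set cfg).

Lemma measurable_open O : open O -> measurable (O : set mcfg).
Proof. by move=> oO; exact: sub_sigma_algebra. Qed.

Lemma measurable_closed K : closed K -> measurable (K : set mcfg).
Proof.
move=> cK; rewrite -(setCK (K : set mcfg)); apply: measurableC.
by apply: measurable_open; rewrite openC.
Qed.

Lemma decreasing_small (D : nat -> set mcfg) (eps : \bar R) :
  (forall n, measurable (D n)) -> (forall m n, (m <= n)%N -> D n `<=` D m) ->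
  (P (\bigcap_n D n) < eps)%E -> exists n, (P (D n) < eps)%E.
Proof.
move=> mD dD Deps.
have cD : P (D n) @[n --> \oo] --> P (\bigcap_n D n).
  apply: nonincreasing_cvg_mu => //.
  - by rewrite (le_lt_trans (probability_le1 _ _)) ?ltry.
  - exact: bigcapT_measurable.
  - by move=> m n mn; apply/subsetPset; exact: dD.
have [n _ /(_ n (leqnn n))] : \forall n \near \oo, (P (D n) < eps)%E.
  apply: (cD [set x | (x < eps)%E]); apply: open_nbhs_nbhs; split=> //.
  exact: open_ereal_lt_ereal.
by exists n.
Qed.

(** Approximation from both sides, which is stable under complement. *)
Definition regular_set (A : set mcfg) : Prop := forall eps : R, 0 < eps ->
  exists K O : set cfg, [/\ closed K, open O, K `<=` A, A `<=` O &
    (P ((O : set mcfg) `\` K) < eps%:E)%E].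

Lemma open_regular O : open O -> regular_set O.
Proof.
move=> oO eps eps0.
(* The interior of [O] at depth [n], a clopen set. *)
pose K n : set cfg := [set w | agree_below c n w `<=` O].
have cK n : closed (K n).
  apply: (closed_determined c_inj (n := n)) => w w' ww' Kw v w'v.
  by apply: Kw => e en; rewrite w'v// ww'.
have KO n : K n `<=` O by move=> w; apply.
have [n Kn] : exists n, (P ((O : set mcfg) `\` K n) < eps%:E)%E.
  apply: decreasing_small => [n|m n' mn w [Ow Kw]|].
  - by apply: measurableD; [exact: measurable_open|exact: measurable_closed].
  - split=> // Kmw; apply: Kw => v wv; apply: Kmw => e em; apply: wv.
    exact: leq_trans mn.
  - rewrite (_ : \bigcap_n _ = set0) ?measure0 ?lte_fin//.
    apply/seteqP; split=> // w Hw; have [Ow _] := Hw 0%N Logic.I.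
    have [n wn] := (open_ptwsP c_inj O).1 oO w Ow.
    by have [_] := Hw n Logic.I; apply.
by exists (K n), O; split.
Qed.

Lemma regularC A : regular_set A -> regular_set (~` A).
Proof.
move=> rA eps eps0; have [K [U [cK oU KA AU PUK]]] := rA eps eps0.
exists (~` U), (~` K); split.
- by rewrite closedC.
- by rewrite openC.
- exact: subsetC.
- exact: subsetC.
- by rewrite setDE setCK setIC -setDE.
Qed.

(** The sets [KO] lose at most half of [eps] together; the other half pays for
replacing the union of the closed sets by a finite, hence closed, one. *)
Lemma regular_bigcup (A : nat -> set mcfg) :
  (forall n, regular_set (A n)) -> regular_set (\bigcup_n A n).
Proof.
move=> rA eps eps0.
have e0 n : 0 < eps / 2 / (2 ^ n.+1)%:R by rewrite !divr_gt0.
have {rA} /choice[KO KOP] n : exists KO : set cfg * set cfg,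
    [/\ closed KO.1, open KO.2, KO.1 `<=` A n, A n `<=` KO.2 &
    (P ((KO.2 : set mcfg) `\` KO.1) < (eps / 2 / (2 ^ n.+1)%:R)%:E)%E].
  by have [K [U KUn]] := rA n _ (e0 n); exists (K, U).
pose O : set cfg := \bigcup_n (KO n).2.
pose K n : set cfg := \bigcup_(i < n) (KO i).1.
have oO : open O by apply: bigcup_open => n _; case: (KOP n).
have cK n : closed (K n).
  apply: closed_bigcup; first exact: finite_II.
  by move=> i _; case: (KOP i).
have mKO n : measurable (((KO n).2 : set mcfg) `\` (KO n).1).
  case: (KOP n) => c1 o2 _ _ _.
  by apply: measurableD; [exact: measurable_open|exact: measurable_closed].
have mD n : measurable ((O : set mcfg) `\` K n).
  by apply: measurableD; [exact: measurable_open|exact: measurable_closed].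
have [n Kn] : exists n, (P ((O : set mcfg) `\` K n) < eps%:E)%E.
  apply: decreasing_small => [//|m n mn w [Ow Kw]|].
    split=> // -[i /= im Kiw]; apply: Kw; exists i => //=.
    exact: leq_trans mn.
  apply: (@le_lt_trans _ _ (\sum_(n <oo) P (((KO n).2 : set mcfg) `\` (KO n).1))%E).
    apply: measure_sigma_subadditive => //; first exact: bigcapT_measurable.
    move=> w Hw; have [[n _ Onw] _] := Hw 0%N Logic.I.
    exists n => //; split=> // Knw; have [_] := Hw n.+1 Logic.I.
    by apply; exists n => /=.
  apply: (@le_lt_trans _ _ (eps / 2)%:E); last by rewrite lte_fin; lra.
  apply: le_trans (epsilon_trick0 xpredT _); last by rewrite divr_ge0// ltW.
  apply: lee_nneseries => [n _ _|n _]; first exact: measure_ge0.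
  by apply/ltW; case: (KOP n).
exists (K n), O; split=> //.
  by move=> w [i _ Kiw]; exists i => //; case: (KOP i) => _ _ h _ _; exact: h.
by move=> w [i _ Aiw]; exists i => //; case: (KOP i) => _ _ _ h _; exact: h.
Qed.

Lemma measurable_regular A : measurable (A : set mcfg) -> regular_set A.
Proof.
apply: smallest_sub => [|O oO]; last exact: open_regular.
split.
- by apply: open_regular; exact: open0.
- by move=> B /regularC; rewrite setTD.
- exact: regular_bigcup.
Qed.

End Regularity.

(** * The FKG inequality *)

Section Patterns.
Variables (T : eqType) (c : T -> nat).
Hypothesis c_inj : injective c.
Local Notation cfg := {ptws T -> bool}.
Local Notation mcfg := (g_sigma_algebraType (@open cfg)).

Definition pattern n (w : cfg) : {set 'I_n} :=
  [set i : 'I_n | `[< forall e, c e = i -> w e >]]%SET.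

(** The coordinates with a code of at least [n] get the default value [true]. *)
Definition of_pattern n (Y : {set 'I_n}) : cfg :=
  fun e => `[< forall i : 'I_n, c e = i -> i \in Y >].

Lemma patternK n w : agree_below c n w (of_pattern (pattern n w)).
Proof.
move=> e en; apply/asboolP/idP => [/(_ (Ordinal en) erefl)|we i ei].
  by rewrite inE => /asboolP; apply.
by rewrite inE; apply/asboolP => e'; rewrite -ei => /c_inj ->.
Qed.

(** Every open set is a countable union of events that depend on finitely many
coordinates. *)
Lemma measurable_cfg d (M : measurableType d) (f : M -> mcfg) :
  (forall e, measurable [set x | f x e]) -> measurable_fun setT f.
Proof.
move=> mf; apply: (@measurability _ _ M mcfg setT f (@open cfg) erefl).
move=> _ [U oU <-]; rewrite setTI.
have -> : f @^-1` U = \bigcup_n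
    ((fun x => pattern n (f x)) @^-1` [set Y | agree_below c n (of_pattern Y) `<=` U]).
  apply/seteqP; split=> [x Ux|x [n _ /= xU]].
    have [n nU] := (open_ptwsP c_inj U).1 oU _ Ux; exists n => // w /= fw.
    by apply: nU => e en; rewrite fw// patternK.
  by apply: xU => e en; rewrite patternK.
apply: bigcupT_measurable => n; apply: measurable_finite_fibers => Y.
apply: measurable_pattern => i.
have [[e ei]|ne] := pselect (exists e, c e = i).
  rewrite (_ : (fun x => _) = [set x | f x e])//; apply/seteqP; split=> x /=.
    exact.
  by move=> fe e'; rewrite -ei => /c_inj ->.
rewrite (_ : (fun x => _) = setT)//; apply/seteqP; split=> // x _ e ei.
by case: ne; exists e.
Qed.

End Patterns.

Section FKG_void.
Variables (T : eqType) (c : T -> nat).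
Hypothesis c_inj : injective c.
Local Notation cfg := {ptws T -> bool}.
Local Notation mcfg := (g_sigma_algebraType (@open cfg)).
Variables (R : realType) (P : probability mcfg R).
Context d (M : measurableType d).
Variables (nu : {measure set M -> \bar R}) (B : T -> set M).
Hypotheses (mB : forall e, measurable (B e)) (Bfin : forall e, (nu (B e) < +oo)%E).
Hypothesis P_void : forall F : set T, finite_set F ->
  P [set w : mcfg | forall e, F e -> w e]
  = (expR (- fine (nu (\bigcup_(e in F) B e))))%:E.
Implicit Types (A K : set cfg).

Definition increasing A : Prop :=
  forall w w' : cfg, A w -> (forall e, w e ==> w' e) -> A w'.

Definition determined n A : Prop :=
  forall w w' : cfg, agree_below c n w w' -> A w -> A w'.

Let mpattern n a : measurable ((pattern c n : mcfg -> _) @^-1` [set a]).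
Proof.
apply: measurable_open; apply: (open_determined c_inj (n := n)).
move=> w w' ww' <-; apply/setP => i; rewrite !inE.
by apply: asbool_equiv_eq; split=> h e ei; have := h e ei; rewrite ww' ?ei.
Qed.

(** On the first [n] coordinates the law of the configuration has the void
probabilities of a thinning, hence is this thinning, to which Harris' inequality
applies. *)
Let FKG_determined n A A' : determined n A -> determined n A' ->
  increasing A -> increasing A' ->
  ((P (A : set mcfg)) * P (A' : set mcfg) <= P ((A : set mcfg) `&` A'))%E.
Proof.
move=> dA dA' iA iA'.
(* As [c] is injective, [b i] is a single [B e], or empty if no [e] has code [i]. *)
pose b (i : 'I_n) := \bigcup_(e in [set e | c e = i]) B e.
have bE i : b i = set0 \/ exists e, b i = B e.
  have [[e ei]|ne] := pselect (exists e, c e = i); [right; exists e|left].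
    apply/seteqP; split=> [x [e' /= ]|x Bx]; last by exists e.
    by rewrite -ei => /c_inj ->.
  by apply/seteqP; split=> // x [e /= ei _]; apply: ne; exists e.
have mb i : measurable (b i) by case: (bE i) => [->//|[e ->]].
have bfin i : (nu (b i) < +oo)%E by case: (bE i) => [->|[e ->]//]; rewrite measure0.
have [s [ps sE]] := void_probability_thinning mb bfin.
pose p (a : {set 'I_n}) : R := fine (P ((pattern c n : mcfg -> _) @^-1` [set a])).
have pfin (U : set mcfg) : measurable U -> P U \is a fin_num.
  by move=> mU; rewrite fin_num_measure.
have Pg (g : pred {set 'I_n}) :
    P [set w : mcfg | g (pattern c n w)] = (\sum_(a | g a) p a)%:E.
  rewrite (measure_finite_fibers P g (mpattern (n:=n))) -sumEFin.
  by apply: eq_bigr => a _; rewrite fineK// pfin//; exact: mpattern.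
have pE g : \sum_X g X * p X = thin s g [set: 'I_n]%SET.
  apply: thin_expectation => S; rewrite sE; apply/EFin_inj; rewrite -Pg.
  have -> : [set w : mcfg | S \subset pattern c n w] =
      [set w | forall e, (exists2 i : 'I_n, i \in S & c e = i) -> w e].
    apply/seteqP; split=> w /=.
      move=> /fintype.subsetP Sw e [i /Sw]; rewrite inE => /asboolP + ei; exact.
    move=> h; apply/fintype.subsetP => i iS; rewrite inE; apply/asboolP => e ei.
    by apply: h; exists i.
  rewrite P_void; last first.
    have : finite_set (c @^-1` [set j : nat | exists2 i : 'I_n, i \in S & j = i]).
      apply: finite_preimage; first by move=> e e' _ _; exact: c_inj.
      by apply: (sub_finite_set _ (finite_II n)) => _ [i _ ->] /=.
    by [].
  congr (expR (- fine (nu _)))%:E; apply/seteqP; split=> x.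
    by move=> [e [i iS ei] Bx]; exists i => //; exists e.
  by move=> [i iS [e /= ei Bx]]; exists e => //; exists i.
have gE A0 : determined n A0 -> A0 = [set w | `[< A0 (of_pattern c (pattern c n w)) >]].
  move=> dA0; apply/seteqP; split=> w.
    by move=> A0w; apply/asboolP; apply: dA0 A0w; exact: patternK c_inj _ _.
  by move=> /asboolP; apply: dA0 => e en; rewrite (patternK c_inj).
pose g A0 (Y : {set 'I_n}) := `[< A0 (of_pattern c Y) >].
have gm A0 : increasing A0 ->
    {homo (fun Y => (g A0 Y)%:R : R) : X Y / X \subset Y >-> X <= Y}.
  move=> iA0 X Y /fintype.subsetP XY; rewrite ler_nat; case: (boolP (g A0 X)) => //.
  move=> /asboolP A0X; rewrite (_ : g A0 Y)//; apply/asboolP.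
  apply: iA0 A0X _ => e; apply/implyP => /asboolP h; apply/asboolP => i ei.
  by apply: XY; exact: h.
have PE A0 : determined n A0 -> P (A0 : set mcfg) =
    (thin s (fun Y => (g A0 Y)%:R) [set: 'I_n]%SET)%:E.
  move=> dA0; rewrite {1}(gE _ dA0) (Pg (g A0)) -pE; congr EFin.
  rewrite big_mkcond; apply: eq_bigr => Y _.
  by case: (g A0 Y); rewrite ?mul1r ?mul0r.
rewrite (PE A)// (PE A')// (PE (A `&` A')); last first.
  by move=> w w' ww' [Aw A'w]; split; [exact: dA Aw|exact: dA' A'w].
rewrite -EFinM lee_fin; apply: le_trans (thin_associated _ ps (gm _ iA) (gm _ iA')) _.
rewrite le_eqVlt; apply/orP; left; apply/eqP; apply: eq_thin => Y.
rewrite -natrM mulnb; congr (nat_of_bool _)%:R.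
by apply/andP/asboolP => [[/asboolP ? /asboolP ?]|[? ?]] //; split; apply/asboolP.
Qed.

(** The increasing event, seen on the first [n] coordinates, that the
configuration lies above some point of [K]. *)
Let fattening K n : set cfg :=
  [set w | exists2 k : cfg, K k & forall e, (c e < n)%N -> k e ==> w e].

Let fattening_determined K n m : (n <= m)%N -> determined m (fattening K n).
Proof.
move=> nm w w' ww' [k Kk kw]; exists k => // e en.
by rewrite ww' ?kw// (leq_trans en).
Qed.

Let fattening_increasing K n : increasing (fattening K n).
Proof.
move=> w w' [k Kk kw] ww'; exists k => // e en.
by apply/implyP => /(implyP (kw e en)) /(implyP (ww' e)).
Qed.

Let fattening_sub K A : closed K -> K `<=` A -> increasing A ->
  \bigcap_n fattening K n `<=` A.
Proof.
move=> cK KA iA w wK.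
have [k Kk kw] := closed_increasing_approx c_inj cK (fun n => wK n Logic.I).
exact: iA (KA _ Kk) kw.
Qed.

Let mfattening K n : measurable (fattening K n : set mcfg).
Proof.
apply: measurable_open; apply: (open_determined c_inj (n := n)).
exact: fattening_determined.
Qed.

(** The fattenings of the closed sets satisfy FKG, and their intersections stay
within [A] and [A']. *)
Let FKG_closed K K' A A' : measurable (A : set mcfg) -> measurable (A' : set mcfg) ->
  increasing A -> increasing A' ->
  closed K -> closed K' -> K `<=` A -> K' `<=` A' ->
  ((P (K : set mcfg)) * P (K' : set mcfg) <= P ((A : set mcfg) `&` A'))%E.
Proof.
move=> mA mA' iA iA' cK cK' KA KA'.
pose D n : set mcfg := fattening K n `&` fattening K' n.
have mD n : measurable (D n) by exact: measurableI.
have cD : P (D n) @[n --> \oo] --> P (\bigcap_n D n).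
  apply: nonincreasing_cvg_mu => //.
  - by rewrite (le_lt_trans (probability_le1 _ _)) ?ltry.
  - exact: bigcapT_measurable.
  - move=> m n mn; apply/subsetPset => w [[k Kk kw] [k' Kk' kw']].
    by split; [exists k|exists k'] => // e en; [apply: kw|apply: kw']; exact: leq_trans mn.
apply: (@le_trans _ _ (P (\bigcap_n D n))); last first.
  apply: le_measure; rewrite ?inE; [exact: bigcapT_measurable|exact: measurableI|].
  by move=> w wD; split; [apply: (fattening_sub cK KA iA)|apply: (fattening_sub cK' KA' iA')];
    move=> n _; have [] := wD n Logic.I.
rewrite -(cvg_lim _ cD)//; apply: lime_ge; first by apply/cvg_ex; exists (P (\bigcap_n D n)).
apply: nearW => n; apply: le_trans (FKG_determined (fattening_determined (leqnn n))
  (fattening_determined (leqnn n)) (@fattening_increasing _ n)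
  (@fattening_increasing _ n)).
by apply: lee_pmul => //; (apply: le_measure; rewrite ?inE;
  [exact: measurable_closed|exact: mfattening|
   by move=> k Kk; exists k => // e _; rewrite implybb]).
Qed.

Lemma FKG_of_void A A' : measurable (A : set mcfg) -> measurable (A' : set mcfg) ->
  increasing A -> increasing A' ->
  ((P (A : set mcfg)) * P (A' : set mcfg) <= P ((A : set mcfg) `&` A'))%E.
Proof.
move=> mA mA' iA iA'.
have pfin (U : set mcfg) : measurable U -> P U \is a fin_num.
  by move=> mU; rewrite fin_num_measure.
have approx (U : set mcfg) eps : 0 < eps -> measurable U ->
    exists K : set cfg, [/\ closed K, K `<=` U & fine (P U) - eps <= fine (P (K : set mcfg))].
  move=> eps0 mU; have [K [V [cK oV KU UV PVK]]] := measurable_regular c_inj P mU eps0.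
  have mK : measurable (K : set mcfg) by exact: measurable_closed.
  have mV : measurable (V : set mcfg) by exact: measurable_open.
  exists K; split=> //; rewrite lerBlDl -lee_fin EFinD !fineK ?pfin//.
  rewrite -[U](setDUK KU) addeC.
  apply: le_trans (measureU2 _ mK (measurableD mU mK)) _; rewrite leeD2l//.
  apply: le_trans (ltW PVK); apply: le_measure; rewrite ?inE//; first exact: measurableD.
    exact: measurableD.
  exact: setSD.
have mAA := measurableI _ _ mA mA'.
rewrite -[P A]fineK ?pfin// -[P A']fineK ?pfin// -[leRHS]fineK ?pfin//.
rewrite -EFinM lee_fin; apply/ler_addgt0Pr => eps eps0.
have e2 : 0 < eps / 2 by rewrite divr_gt0.
have [K [cK KA PK]] := approx A _ e2 mA.
have [K' [cK' KA' PK']] := approx A' _ e2 mA'.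
have mK : measurable (K : set mcfg) by exact: measurable_closed.
have mK' : measurable (K' : set mcfg) by exact: measurable_closed.
have := FKG_closed mA mA' iA iA' cK cK' KA KA'.
rewrite -[P K]fineK ?pfin// -[P K']fineK ?pfin// -[leRHS]fineK ?pfin//.
rewrite -EFinM lee_fin.
have le1 (U : set mcfg) : measurable U -> 0 <= fine (P U) <= 1.
  by move=> mU; rewrite fine_ge0//= -lee_fin fineK ?pfin// probability_le1.
have := le1 _ mK; have := le1 _ mK'; have := le1 _ mA; have := le1 _ mA'.
move: PK PK'.
move: (fine (P A)) (fine (P A')) (fine (P K)) (fine (P K')) (fine (P _)) => a a' k k' m.
move=> ak ak' /andP[? ?] /andP[? ?] /andP[? ?] /andP[? ?] km.
nra.
Qed.

End FKG_void.

(** * Kernels and countability *)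

(** The section at [z] of the symmetric difference of two subgraphs is the
interval between [f x z] and [f y z]. *)
Lemma L1_kernel_measure_definite (R : realType) (X : Type) (k : X -> X -> R) :
  L1_kernel k -> measure_definite_kernel k.
Proof.
move=> [d [Y [nu [f kE]]]].
have mf x : measurable_fun setT (f x : Y -> R).
  exact: (measurable_funPT (repr (f x : {mfun_ nu, Y >-> measurableTypeR R}))).
pose S x : set (Y * measurableTypeR R) := [set p | p.2 < f x p.1].
have mS x : measurable (S x).
  have -> : S x = [set: Y * measurableTypeR R] `&`
      [set p | p.2 < f x p.1] by rewrite setTI.
  have h : measurable_fun [set: Y * measurableTypeR R]
      (fun p : Y * measurableTypeR R => (p.2 < f x p.1)).
    apply: measurable_fun_ltr; first exact: measurable_snd.
    by apply: (measurableT_comp (mf x)); exact: measurable_fst.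
  by apply: (h measurableT [set true]).
exists _, (Y * measurableTypeR R)%type, (nu \x @lebesgue_measure R)%E, S.
split=> // x y; rewrite kE Lnorm1; apply: eq_integral => z _ /=.
rewrite (_ : xsection _ _ = `[Num.min (f x z) (f y z), Num.max (f x z) (f y z)[%classic).
  rewrite lebesgue_measure_itv/= lte_fin minEle maxEle.
  case: (lerP (f x z) (f y z)) => xy; last by rewrite xy.
  by case: (ltrgtP (f x z) (f y z)) xy => // ->; rewrite subrr.
apply/seteqP; split=> s.
  rewrite /xsection/= inE/= in_itv/= ge_min lt_max.
  by case=> -[-> /negP]; rewrite -leNgt => ->; rewrite ?orbT.
rewrite /xsection/= inE/= in_itv/= ge_min lt_max => /andP[+ +].
case: (ltrP s (f x z)) => xs; case: (ltrP s (f y z)) => ys //= _ _;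
  [left|right]; split=> //=; apply/negP; rewrite -leNgt//.
Qed.

(** The balls around a vertex are finite, by induction on the radius. *)
Lemma edges_countable (V : Type) (E : set (set V)) :
  undirected_graph E -> locally_finite_graph E -> connected_graph E ->
  countable [set: V] /\ countable E.
Proof.
move=> hG hlf hconn.
have [v0|V0] := pselect (exists v : V, True); last first.
  split.
    rewrite (_ : [set: V] = set0)//.
    by apply/seteqP; split=> // v; case: V0; exists v.
  rewrite (_ : E = set0)//.
  by apply/seteqP; split=> // e /hG[u]; case: V0; exists u.
have {v0} [v0 _] := v0.
have ball n : finite_set [set v | walk E n v0 v].
  elim: n => [|n IH].
    apply: (sub_finite_set _ (finite_set1 v0)) => v [p [_ <- /size0nil ->]] //.
  have star v : finite_set (\bigcup_(e in [set e | E e /\ e v]) e).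
    apply: bigcup_finite => // e [/hG[a [b ->]] _].
    exact: finite_set2.
  apply: (sub_finite_set _ (bigcup_finite IH (fun v _ => star v))).
  move=> v [p [pp lp sp]]; case/lastP: p pp lp sp => // p v' + + /eqP.
  rewrite rcons_path last_rcons size_rcons eqSS.
  move=> /andP[pp /asboolP Ev] lv /eqP sp; rewrite {v'}lv in Ev.
  exists (last v0 p); first by exists p.
  exists [set last v0 p; v]; first by split=> //; left.
  by right.
have cV : countable [set: V].
  rewrite (_ : [set: V] = \bigcup_n [set v | walk E n v0 v]).
    by apply: bigcup_countable => // n _; exact: finite_set_countable.
  by apply/seteqP; split=> // v _; have [n] := hconn v0 v; exists n.
split=> //.
rewrite (_ : E = \bigcup_v [set e | E e /\ e v]).
  by apply: bigcup_countable => // v _; exact: finite_set_countable.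
apply/seteqP; split=> [e Ee|e [v _ []]//].
by have [u [v e_uv]] := hG e Ee; exists u => //; split=> //; rewrite e_uv; left.
Qed.

(** * Void events indexed by time *)

(** The events that [B i] is void, for any countable family: its members are
relabelled by their codes, and labels that are no code get the empty set. *)
Lemma exists_void_field (R : realType) (T : Type) (c : T -> nat)
    (c_inj : injective c) d (M : measurableType d)
    (nu : {measure set M -> \bar R}) (B : T -> set M) :
  (forall i, measurable (B i)) -> (forall i, (nu (B i) < +oo)%E) ->
  exists X : T -> measurableTypeR R -> bool,
    (forall i, measurable [set x | X i x]) /\
    (forall F : set T, (nu (\bigcup_(i in F) B i) < +oo)%E ->
      lebesgue01 [set x | forall i, F i -> X i x]
      = (expR (- fine (nu (\bigcup_(i in F) B i))))%:E).
Proof.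
move=> mB Bfin.
pose b n := \bigcup_(i in [set i | c i = n]) B i.
have bE n : b n = set0 \/ exists i, b n = B i.
  have [[i ei]|ne] := pselect (exists i, c i = n); [right; exists i|left].
    apply/seteqP; split=> [x [j /= ]|x Bx]; last by exists i.
    by rewrite -ei => /c_inj ->.
  by apply/seteqP; split=> // x [i /= ei _]; apply: ne; exists i.
have mb n : measurable (b n) by case: (bE n) => [->//|[e ->]].
have bfin n : (nu (b n) < +oo)%E by case: (bE n) => [->|[e ->]//]; rewrite measure0.
exists (fun i => bit (void_prob nu b) (c i)); split=> [i|F].
  exact: measurable_bit.
have -> : \bigcup_(i in F) B i = \bigcup_(n in c @` F) b n.
  apply/seteqP; split=> [x [i Fi Bx]|x [_ [i Fi <-] [j /= /c_inj -> Bx]]].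
    by exists (c i); [exists i|exists i].
  by exists i.
move=> /(lebesgue01_bits mb bfin) <-; congr (lebesgue01 _).
apply/seteqP; split=> x /= H; first by move=> _ [i Fi <-]; exact: H.
by move=> i Fi; apply: H; exists i.
Qed.

Section FreeTimes.
Variables (R : realType) (T : Type) (c : T -> nat).
Hypothesis c_inj : injective c.
Context d (Omega : measurableType d).
Variables (mu : {measure set Omega -> \bar R}) (A : T -> set Omega).
Hypotheses (mA : forall i, measurable (A i)) (Afin : forall i, (mu (A i) < +oo)%E).

Lemma measure_strip (U : set Omega) (t : R) : measurable U -> 0 <= t ->
  (mu \x (@lebesgue_measure R))%E (U `*` `[0, t[%classic) = (mu U * t%:E)%E.
Proof.
move=> mU t0; rewrite product_measure1E//; congr (_ * _)%E.
have : lebesgue_measure (`[0, t[%classic : set R) = t%:E.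
  rewrite lebesgue_measure_itv/= lte_fin oppr0 adde0.
  by case: ltrgtP t0 => // <-.
exact.
Qed.

(** [free t i x] says that no point falls into [A i] before the time [t]. Asking
this at all the rational times up to [t] makes it monotone in [t] for every [x],
while the strips [A i `*` [0, q[] still add up to [A i `*` [0, t[]. *)
Lemma exists_free_field :
  exists free : R -> T -> measurableTypeR R -> bool,
  [/\ (forall t i, measurable [set x | free t i x]),
      (forall s t i x, s < t -> free t i x -> free s i x) &
      (forall t (F : set T), 0 < t -> measurable (\bigcup_(i in F) A i) ->
         (mu (\bigcup_(i in F) A i) < +oo)%E ->
         lebesgue01 [set x | forall i, F i -> free t i x]
         = (expR (- (t * fine (mu (\bigcup_(i in F) A i)))))%:E)].
Proof.
(* The maximum makes the strips of negative heights empty. *)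
pose B (iq : T * rat) : set (Omega * measurableTypeR R) :=
  A iq.1 `*` `[0, Num.max 0 (ratr iq.2)[%classic.
pose c' (iq : T * rat) : nat := pickle (c iq.1, iq.2).
have c'_inj : injective c'.
  by move=> [i q] [j r] /(pcan_inj pickleK) [/c_inj -> ->].
have max0 (q : rat) : 0 <= Num.max 0 (ratr q) :> R by rewrite le_max lexx.
have mB iq : measurable (B iq) by apply: measurableX => //; exact: measurable_itv.
have Bfin iq : ((mu \x (@lebesgue_measure R))%E (B iq) < +oo)%E.
  rewrite measure_strip//; apply: lte_mul_pinfty => //; last exact: ltry.
  by rewrite ge0_fin_numE.
have [X [mX XE]] := exists_void_field c'_inj mB Bfin.
exists (fun t i x => `[< forall q : rat, ratr q <= t -> X (i, q) x >]); split.
- move=> t i; rewrite (_ : [set x | _] =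
      \bigcap_(q in [set: rat]) [set x | ratr q <= t -> X (i, q) x]).
    rewrite -[X in measurable X]setCK setC_bigcap; apply: measurableC.
    apply: bigcupT_measurable_rat => q; apply: measurableC.
    have [qt|/negP qt] := pselect (ratr q <= t).
      have -> : [set x | ratr q <= t -> X (i, q) x] = [set x | X (i, q) x].
        by apply/seteqP; split=> x /=; [exact|move=> ? _].
      exact: mX.
    have -> : [set x | ratr q <= t -> X (i, q) x] = setT.
      by apply/seteqP; split=> x //= _; rewrite (negbTE qt).
    exact: measurableT.
  apply/seteqP; split=> x /=; first by move=> /asboolP H q _; exact: H.
  by move=> H; apply/asboolP => q; exact: H.
- move=> s t i x st /asboolP H; apply/asboolP => q qs; apply: H.
  exact: le_trans qs (ltW st).
move=> t F t0 mF Ffin.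
pose G : set (T * rat) := [set iq | F iq.1 /\ ratr iq.2 <= t].
have GE : \bigcup_(iq in G) B iq = (\bigcup_(i in F) A i) `*` `[0, t[%classic.
  apply/seteqP; split=> [[w s] [[i q] [/= Fi qt] [/= Aw]]|[w s] [/= [i Fi Aw]]].
    rewrite /= !in_itv/= => /andP[s0 sq]; split; first by exists i.
    by rewrite /= s0 (lt_le_trans sq)// ge_max (ltW t0).
  rewrite /= in_itv/= => /andP[s0 st].
  have [q] := rat_in_itvoo st; rewrite in_itv/= => /andP[sq qt].
  exists (i, q); first by split=> //=; exact: ltW.
  by split=> //=; rewrite in_itv/= s0 lt_max sq orbT.
rewrite (_ : [set x | _] = [set x | forall iq, G iq -> X iq x]).
  have stripE := measure_strip mF (ltW t0).
  rewrite XE GE; first by rewrite [X in fine X]stripE muleC fineM// ge0_fin_numE.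
  rewrite [X in (X < _)%E]stripE; apply: lte_mul_pinfty => //; last exact: ltry.
  by rewrite ge0_fin_numE.
apply/seteqP; split=> x /= H; first by move=> [i q] [/= Fi qt]; have /asboolP := H _ Fi; apply.
by move=> i Fi; apply/asboolP => q qt; exact: (H (i, q)).
Qed.

End FreeTimes.

(** * Paths, edges and symmetric differences *)

Lemma symdiff_edge (V Omega : Type) (S : V -> set Omega) (a b u v : V) :
  [set a; b] = [set u; v] -> S a `+` S b = S u `+` S v.
Proof.
move=> ab_uv.
have : [set u; v] a by rewrite -ab_uv; left.
have : [set u; v] b by rewrite -ab_uv; right.
have : [set a; b] u by rewrite ab_uv; left.
have : [set a; b] v by rewrite ab_uv; right.
by move=> /= [?|?] [?|?] [?|?] [?|?]; subst => //; rewrite setYC.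
Qed.

(** The list [l] consists of the edges of the path: the symmetric differences
along them cover that of the end points, and the path stays open as long as they
are. *)
Lemma path_edges (V Omega : Type) (S : V -> set Omega) (E E' : set (set V))
    (ends : E -> V * V) :
  (forall e : E, val e = [set (ends e).1; (ends e).2]) -> E' `<=` E ->
  forall p u, path (adj E') u p -> exists l : seq E,
  [/\ size l = size p, forall e, e \in l -> E' (val e),
      S u `+` S (last u p) `<=`
        \bigcup_(e in [set` l]) (S (ends e).1 `+` S (ends e).2) &
      forall E'' : set (set V), (forall e, e \in l -> E'' (val e)) ->
        path (adj E'') u p].
Proof.
move=> endsE E'E; elim=> [|v p IH] u /=.
  by exists [::]; split=> //; rewrite setYK; exact: sub0set.
move=> /andP[/asboolP E'uv /IH[l [sl lE' lS lp]]].
pose e : E := exist (fun x => x \in E) _ (mem_set (E'E _ E'uv)).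
exists (e :: l); split=> /=.
- by rewrite sl.
- by move=> e'; rewrite inE => /orP[/eqP ->|/lE'].
- move=> x xS; have [xuv|xuv] := pselect ((S u `+` S v) x).
    exists e; first by rewrite /= mem_head.
    by rewrite (@symdiff_edge _ _ S _ _ u v)// -endsE.
  have [e' /= e'l xe'] : (\bigcup_(e in [set` l]) (S (ends e).1 `+` S (ends e).2)) x.
    apply: lS; move: xS xuv; rewrite /setY /setD /setU/=.
    by have [?|?] := pselect (S v x); have [?|?] := pselect (S u x); tauto.
  by exists e' => //=; rewrite inE e'l orbT.
- move=> E'' lE''; apply/andP; split; last first.
    by apply: lp => e' e'l; apply: lE''; rewrite inE e'l orbT.
  by apply/asboolP; apply: (lE'' e); rewrite mem_head.
Qed.

Lemma open_edgesE (V : Type) (E : set (set V)) (w : config E) (e : E) :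
  open_edges w (val e) <-> w e.
Proof. by split=> [[e' /= we' /val_inj <-]|we]; last exists e. Qed.

Lemma open_edges_sub (V : Type) (E : set (set V)) (w : config E) :
  open_edges w `<=` E.
Proof. by move=> _ [e _ <-]; exact: set_mem (valP e). Qed.

Lemma bigcup_seq_lee d (T : measurableType d) (R : realType)
    (mu : {measure set T -> \bar R}) (J : choiceType) (l : seq J) (B : J -> set T) (r : R) :
  (forall j, measurable (B j)) -> (forall j, j \in l -> (mu (B j) <= r%:E)%E) ->
  (mu (\bigcup_(j in [set` l]) B j) <= ((size l)%:R * r)%:E)%E.
Proof.
move=> mB; rewrite bigcup_seq; elim: l => [|j l IH] lr.
  by rewrite big_nil measure0 mul0r.
rewrite big_cons; apply: le_trans (measureU2 _ _ _) _ => //.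
  exact: bigsetU_measurable.
rewrite [size _]/= -add1n natrD mulrDl mul1r EFinD; apply: leeD.
  by apply: lr; rewrite mem_head.
by apply: IH => i il; apply: lr; rewrite inE il orbT.
Qed.

Lemma measure_finite_bigcup_lty d (T : measurableType d) (R : realType)
    (mu : {measure set T -> \bar R}) (J : choiceType) (F : set J) (B : J -> set T) :
  finite_set F -> (forall j, measurable (B j)) -> (forall j, (mu (B j) < +oo)%E) ->
  (mu (\bigcup_(j in F) B j) < +oo)%E.
Proof.
move=> /finite_seqP[l ->] mB Bfin.
rewrite bigcup_seq; elim: l => [|j l IH]; first by rewrite big_nil measure0.
rewrite big_cons.
apply: le_lt_trans (measureU2 _ _ _) _ => //; last first.
  by rewrite lte_add_pinfty// Bfin.
exact: bigsetU_measurable.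
Qed.

(** * The percolation of a measure definite kernel *)

Section Percolation.
Variables (R : realType) (V : Type) (E : set (set V)).
Hypothesis hconn : connected_graph E.
Variable cE : E -> nat.
Hypothesis cE_inj : injective cE.
Context d (Omega : measurableType d).
Variables (mu : {measure set Omega -> \bar R}) (S : V -> set Omega).
Variable k : V -> V -> R.
Hypothesis mS : forall x, measurable (S x).
Hypothesis kE : forall x y, (k x y)%:E = mu (S x `+` S y).
Variable ends : E -> V * V.
Hypothesis endsE : forall e : E, val e = [set (ends e).1; (ends e).2].

Let A (p : V * V) : set Omega := S p.1 `+` S p.2.

Let mA p : measurable (A p).
Proof. by apply: measurableU; apply: measurableD. Qed.

Let AE p : mu (A p) = (k p.1 p.2)%:E.
Proof. by rewrite kE. Qed.

Let Afin p : (mu (A p) < +oo)%E.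
Proof. by rewrite AE ltry. Qed.

Variable free : R -> V * V -> measurableTypeR R -> bool.
Hypothesis mfree : forall t p, measurable [set x | free t p x].
Hypothesis freeP : forall t (F : set (V * V)), 0 < t ->
  measurable (\bigcup_(p in F) A p) -> (mu (\bigcup_(p in F) A p) < +oo)%E ->
  lebesgue01 [set x | forall p, F p -> free t p x]
  = (expR (- (t * fine (mu (\bigcup_(p in F) A p)))))%:E.

Definition perc (t : R) (x : measurableTypeR R) : config E :=
  fun e => free t (ends e) x.

Lemma measurable_perc t : measurable_fun setT (perc t).
Proof. by apply: (measurable_cfg cE_inj) => e; exact: mfree. Qed.

Definition perc_rv (t : R) : {mfun measurableTypeR R >-> config E} :=
  mfun_Sub (mem_set (measurable_perc t)).

Definition perc_law (t : R) : probability (config E) R :=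
  distribution (@lebesgue01 R) (perc_rv t).

Lemma perc_lawE t (U : set (config E)) : perc_law t U = lebesgue01 [set x | U (perc t x)].
Proof. by []. Qed.

Lemma perc_law_void t (F : set E) : 0 < t -> finite_set F ->
  perc_law t [set w : config E | forall e, F e -> w e]
  = (expR (- (t * fine (mu (\bigcup_(e in F) A (ends e))))))%:E.
Proof.
move=> t0 Ffin; rewrite perc_lawE.
rewrite (_ : [set x | _] = [set x | forall p, (ends @` F) p -> free t p x]).
  rewrite freeP// bigcup_image//; first by apply: fin_bigcup_measurable.
  exact: (@measure_finite_bigcup_lty _ _ _ _ _ F (fun e => A (ends e))).
apply/seteqP; split=> x /= H; first by move=> _ [e Fe <-]; exact: H.
by move=> e Fe; apply: H; exists e.
Qed.

Lemma perc_law_FKG t : 0 < t -> FKG (perc_law t).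
Proof.
move=> t0 U U' [mU iU] [mU' iU'].
(* The points that fall before time [t] have intensity [t mu]. *)
pose nu := mscale (NngNum (ltW t0)) mu.
have nuE B : nu B = (t%:E * mu B)%E by [].
apply: (FKG_of_void cE_inj (nu := nu) (B := fun e => A (ends e))) => //.
- move=> e; rewrite [X in (X < _)%E]nuE AE -EFinM ltry//.
- move=> F Ffin; rewrite [LHS](perc_law_void t0 Ffin); congr (expR (- _))%:E.
  rewrite [X in _ = fine X]nuE fineM// ge0_fin_numE//.
  exact: (@measure_finite_bigcup_lty _ _ _ _ _ F (fun e => A (ends e))).
Qed.

Lemma k_edge (e : E) u v : val e = [set u; v] -> mu (A (ends e)) = (k u v)%:E.
Proof. by rewrite endsE kE /A => /(symdiff_edge S) ->. Qed.

Lemma perc_law_edge t (e : E) u v : 0 < t -> val e = [set u; v] ->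
  perc_law t [set w : config E | w e] = (expR (- (t * k u v)))%:E.
Proof.
move=> t0 euv.
rewrite (_ : [set w | _] = [set w : config E | forall e', [set e] e' -> w e']).
  by rewrite perc_law_void// bigcup_set1 (k_edge euv).
by apply/seteqP; split=> w /= => [we _ -> //|]; apply.
Qed.

Lemma measurable_same_cluster u v : measurable (same_cluster E u v).
Proof.
apply: measurable_open; apply/(open_ptwsP cE_inj) => w [n [p [pw lp sp]]].
have [l [_ lw _ lE]] := path_edges S endsE (@open_edges_sub _ _ w) pw.
exists (\max_(e <- l) (cE e).+1)%N => w' ww'; exists n, p; split=> //.
apply: lE => e el; apply/open_edgesE; rewrite ww'; first by apply/open_edgesE; exact: lw.
by rewrite (big_rem e)//= leq_max leqnn.
Qed.

(** The set of [u] and [v] need not be an edge, but it has a void event too. Almost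
surely this event occurs as soon as the edges of a path from [u] to [v] are open:
their sets cover [A (u, v)], which adds nothing to the void probability. There
are countably many finite sets of edges. *)
Lemma perc_law_cluster_le t u v : 0 < t ->
  (perc_law t (same_cluster E u v) <= (expR (- (t * k u v)))%:E)%E.
Proof.
move=> t0.
(* The finite sets of edges, enumerated by the codes of lists of edge labels. *)
pose D (n : nat) : set E := [set e | cE e \in (odflt [::] (unpickle n) : seq nat)].
have Dfin n : finite_set (D n).
  have : finite_set (cE @^-1` [set` (odflt [::] (unpickle n) : seq nat)]) => //.
  apply: finite_preimage; first by move=> e e' _ _; exact: cE_inj.
  exact: finite_seq.
have mDA n : measurable (\bigcup_(e in D n) A (ends e)).
  by apply: fin_bigcup_measurable.
have DAfin n : (mu (\bigcup_(e in D n) A (ends e)) < +oo)%E.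
  exact: (@measure_finite_bigcup_lty _ _ _ _ _ _ (fun e => A (ends e))).
pose H : set (measurableTypeR R) := [set x | free t (u, v) x].
pose G n : set (measurableTypeR R) :=
  [set x | forall p, ((fun e => ends e) @` D n) p -> free t p x].
have mG n : measurable (G n).
  rewrite (_ : G n = \bigcap_(e in D n) [set x | free t (ends e) x]).
    by apply: fin_bigcap_measurable.
  apply/seteqP; split=> x /= h; first by move=> e De; apply: h; exists e.
  by move=> _ [e De <-]; exact: h.
have mH : measurable H by exact: mfree.
pose good n := A (u, v) `<=` \bigcup_(e in D n) A (ends e).
have null n : good n -> lebesgue01 (G n `\` H) = 0%E.
  move=> gn; rewrite measureD//; last first.
    by rewrite (le_lt_trans (probability_le1 _ _)) ?ltry.
  rewrite (_ : G n `&` H =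
    [set x | forall p, ((u, v) |` ((fun e => ends e) @` D n)) p -> free t p x]).
    have GE := freeP (F := (fun e => ends e) @` D n) t0.
    have GHE := freeP (F := (u, v) |` ((fun e => ends e) @` D n)) t0.
    have UE : \bigcup_(p in (u, v) |` ((fun e => ends e) @` D n)) A p
        = \bigcup_(e in D n) A (ends e).
      by rewrite bigcup_setU1 bigcup_image; apply/setUidPr.
    rewrite bigcup_image in GE; rewrite UE in GHE.
    by rewrite [X in (X - _)%E]GE// [X in (_ - X)%E]GHE// -EFinB subrr.
  apply/seteqP; split=> x /=; first by move=> [h1 h2] p [->|/h1].
  by move=> h; split=> [p Dp|]; apply: h; [right|left].
(* Off the null set [N], no finite set of edges covering the symmetric difference
   of [u] and [v] is open unless the latter is void as well. *)
pose N := \bigcup_n (if `[< good n >] then G n `\` H else set0).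
have mN : measurable N.
  by apply: bigcupT_measurable => n; case: asboolP => // _; exact: measurableD.
have N0 : lebesgue01 N = 0%E.
  apply/eqP; rewrite eq_le measure_ge0 andbT.
  apply: (@le_trans _ _ (\sum_(n <oo)
      lebesgue01 (if `[< good n >] then G n `\` H else set0))%E).
    apply: measure_sigma_subadditive => //.
    by move=> n; case: asboolP => // _; exact: measurableD.
  by rewrite eseries0// => n _ _; case: asboolP => [/null //|_]; rewrite measure0.
have HE : lebesgue01 H = (expR (- (t * k u v)))%:E.
  rewrite (_ : H = [set x | forall p, [set (u, v)] p -> free t p x]).
    by rewrite freeP ?bigcup_set1 ?AE ?ltry.
  by apply/seteqP; split=> x /=; [move=> h _ ->|apply].
rewrite -HE perc_lawE; apply: (@le_trans _ _ (lebesgue01 (H `|` N))); last first.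
  by rewrite (le_trans (measureU2 _ _ _))// [X in (_ + X)%E]N0 adde0.
apply: le_measure; rewrite ?inE.
- rewrite -[X in measurable X]setTI; apply: measurable_perc => //.
  exact: measurable_same_cluster.
- exact: measurableU.
move=> x [n [p [pw lp sp]]].
have [Hx|nHx] := pselect (H x); [by left|right].
have [l [_ lw lS _]] := path_edges S endsE (@open_edges_sub _ _ (perc t x)) pw.
have Dl : D (pickle (map cE l)) = [set` l].
  by rewrite /D pickleK /=; apply/seteqP; split=> e /=; rewrite mem_map.
exists (pickle (map cE l)) => //; rewrite asboolT; last first.
  by rewrite /good Dl -lp.
split=> // _ [e + <-]; rewrite Dl /= => /lw /open_edgesE.
exact.
Qed.

(** All the edges of a geodesic are open with at least this probability. *)
Lemma perc_law_cluster_ge t u v : 0 < t ->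
  (expeR (- (t%:E * edge_sup E k * (gdist E u v)%:R%:E))
   <= perc_law t (same_cluster E u v))%E.
Proof.
move=> t0.
have [p [pE lp sp]] : walk E (gdist E u v) u v.
  have [n un] := hconn u v.
  have [m /asboolP mw mmin] :=
    ex_minnP (ex_intro (fun n => `[< walk E n u v >]) n (asboolT un)).
  have /getI[] // : [set n | walk E n u v /\ forall m, walk E m u v -> (n <= m)%N] m.
  by split=> // m' /asboolT /mmin.
have [l [sl _ _ lP]] := path_edges S endsE (@subset_refl _ E) pE.
(* For [u = v] the infinite supremum meets the convention [+oo * 0 = 0]. *)
have [n0|n0] := eqVneq (gdist E u v) 0%N.
  rewrite n0 mule0 oppe0 expeR0.
  rewrite (_ : same_cluster _ _ _ = setT) ?probability_setT//.
  move: n0; rewrite -sp => /size0nil p0; rewrite -lp p0 /=.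
  by apply/seteqP; split=> // w _; exists 0%N, [::].
have kle a b : adj E a b -> ((k a b)%:E <= edge_sup E k)%E.
  move=> Eab; rewrite /edge_sup; case: asboolP => E0.
    by move: Eab; rewrite /adj E0 => /asboolP.
  by apply: ereal_sup_ubound; exists a, b.
have ksup (e : E) : (mu (A (ends e)) <= edge_sup E k)%E.
  by rewrite AE; apply: kle; apply/asboolP; rewrite -endsE; exact: set_mem (valP e).
have sup0 : (0 <= edge_sup E k)%E.
  move: n0; rewrite -sp -sl; case: (l) => // e _ _.
  by apply: le_trans (ksup e).
case: (edge_sup E k) sup0 ksup => [r r0 ksup|_ _|//]; last first.
  rewrite gt0_muley ?lte_fin// gt0_mulye ?lte_fin ?ltr0n ?lt0n//=.
apply: (@le_trans _ _ (perc_law t [set w : config E | forall e, [set` l] e -> w e])).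
  rewrite perc_law_void//; last exact: finite_seq.
  rewrite -!EFinM /= lee_fin ler_expR lerN2 -mulrA ler_pM2l// mulrC.
  rewrite -sp -sl -lee_fin fineK.
    by apply: bigcup_seq_lee => // e _; exact: ksup.
  rewrite ge0_fin_numE//.
  apply: (@measure_finite_bigcup_lty _ _ _ _ _ _ (fun e => A (ends e))) => //.
  exact: finite_seq.
apply: le_measure; rewrite ?inE.
- apply: measurable_open; apply/(open_ptwsP cE_inj) => w wl.
  exists (\max_(e <- l) (cE e).+1)%N => w' ww' e /= el; rewrite ww' ?wl//.
  by rewrite (big_rem e)//= leq_max leqnn.
- exact: measurable_same_cluster.
- move=> w wl; exists (size p), p; split=> //.
  by apply: lP => e el; apply/open_edgesE; exact: wl.
Qed.

End Percolation.

Theorem corollary4p6 (R : realType) (V : Type) (E : set (set V))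
    (k : V -> V -> R)
    (hG : undirected_graph E) (hlf : locally_finite_graph E)
    (hconn : connected_graph E)
    (k_ge0 : forall u v, 0 <= k u v)
    (hk : measure_definite_kernel k \/ L1_kernel k) :
  exists P : R -> probability (config E) R,
    (forall t : R, 0 < t ->
       [/\ FKG (P t),
           forall (e : E) (u v : V), val e = [set u; v] ->
             P t [set w : config E | w e] = (expR (- (t * k u v)))%:E
         & forall u v : V,
             (expeR (- (t%:E * edge_sup E k * (gdist E u v)%:R%:E))
                <= P t (same_cluster E u v))%E /\
             (P t (same_cluster E u v) <= (expR (- (t * k u v)))%:E)%E]) /\
    decreasing_coupling P.
Proof.
have [d [M [mu [S [mS kE]]]]] : measure_definite_kernel k.
  by case: hk => // /L1_kernel_measure_definite.
have [/countable_injP[cV cV_inj] /countable_injP[f f_inj]] := edges_countable hG hlf hconn.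
have {}cV_inj : injective cV by move=> u v; apply: cV_inj; rewrite inE.
pose cE (e : E) := f (val e).
have cE_inj : injective cE.
  by move=> e e' /f_inj h; apply/val_inj/h; exact: valP.
have /choice[ends endsE] (e : E) : exists p : V * V, val e = [set p.1; p.2].
  by have [u [v ->]] := hG _ (set_mem (valP e)); exists (u, v).
have code_inj : injective (fun p : V * V => pickle (cV p.1, cV p.2)).
  by move=> [u v] [u' v'] /(pcan_inj pickleK) [/cV_inj -> /cV_inj ->].
have mA (p : V * V) : measurable (S p.1 `+` S p.2).
  by apply: measurableU; apply: measurableD.
have Afin (p : V * V) : (mu (S p.1 `+` S p.2) < +oo)%E by rewrite -kE ltry.
have [free [mfree free_mono freeP]] := exists_free_field code_inj mA Afin.
exists (fun t => perc_law cE_inj ends mfree t); split.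
  move=> t t0; split.
  - exact: (perc_law_FKG cE_inj mS kE ends mfree freeP t0).
  - move=> e u v; exact: (perc_law_edge cE_inj mS kE endsE mfree freeP t0).
  - move=> u v; split.
      exact: (perc_law_cluster_ge hconn cE_inj mS kE endsE mfree freeP u v t0).
    exact: (perc_law_cluster_le cE_inj mS kE endsE mfree freeP u v t0).
exists _, (measurableTypeR R), (@lebesgue01 R), (fun t => perc_rv cE_inj ends mfree t).
split=> [//|s t s0 st x e]; apply/implyP; exact: free_mono.
Qed.
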